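(* Let $S$ be a semigroup, let $T$ be a subsemigroup of $S$ with finite Green index, and let $\{H_i:i\in I\}$ be the $T$-relative $\mathscr{H}$-classes in the complement $S\setminus T$. Then $S$ is finitely generated if and only if $T$ is finitely generated, in which case all the relative Schützenberger groups $\Gamma(H_i)$ $(i\in I)$ are finitely generated as well.
   Context: For a semigroup $S$, $S^1=S\cup\{1\}$ denotes $S$ with a new identity element $1\notin S$ adjoined; for $X\subseteq S$, $X^1=X\cup\{1\}$. For a subsemigroup $T$ of $S$ and $u,v\in S$: $u\,\mathscr{R}^T v$ iff $uT^1=vT^1$; $u\,\mathscr{L}^T v$ iff $T^1u=T^1v$; $\mathscr{H}^T=\mathscr{R}^T\cap\mathscr{L}^T$. The classes of $\mathscr{H}^T$ are the $T$-relative $\mathscr{H}$-classes; each lies wholly in $T$ or wholly in $S\setminus T$. The Green index of $T$ in $S$ is one more than the number of $T$-relative $\mathscr{H}$-classes contained in $S\setminus T$. For a $T$-relative $\mathscr{H}$-class $H$, let $\mathrm{Stab}(H)=\{t\in T^1: Ht=H\}$ and let $\gamma=\gamma(H)$ be the congruence on $\mathrm{Stab}(H)$ given by $(x,y)\in\gamma$ iff $hx=hy$ for all $h\in H$. The quotient $\Gamma(H)=\mathrm{Stab}(H)/\gamma$ is a group, called the ($T$-)relative Schützenberger group of $H$. *)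

(* Defs.v *)
From HB Require Import structures.
From mathcomp Require Import all_boot generic_quotient.
From mathcomp Require Import all_classical.

Set Implicit Arguments.
Unset Strict Implicit.
Unset Printing Implicit Defensive.

Local Open Scope classical_set_scope.
Local Open Scope group_scope.
Local Open Scope quotient_scope.

(* Generation is expressed inside the ambient structure: the set generated by
   X is the intersection of all subsemigroups (resp. subgroups) containing X. *)
Definition semigroup_generated (S : semigroupType) (X : set S) : set S :=
  smallest [set A : set S | mulg_closed [in A]] X.

Definition semigroup_fg (S : semigroupType) (A : set S) : Prop :=
  exists2 X : set S, finite_set X & semigroup_generated X = A.

Definition group_generated (G : groupType) (X : set G) : set G :=
  smallest [set A : set G | group_closed [in A]] X.

Definition group_fg (G : groupType) : Prop :=
  exists2 X : set G, finite_set X & group_generated X = [set: G].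

(* S^1: the new identity is None, adjoined even when S already has one. *)
Definition adjoin1 (S : Type) : Type := option S.

Definition inc {S : Type} (u : S) : adjoin1 S := Some u.

Section Adjoin1.
Variable S : semigroupType.

HB.instance Definition _ := Choice.copy (adjoin1 S) (option S).

Definition mul1 (s t : adjoin1 S) : adjoin1 S :=
  match s, t with
  | Some x, Some y => Some (x * y)
  | Some x, None => Some x
  | None, _ => t
  end.

Fact mul1A : associative mul1.
Proof. by move=> [x|] [y|] [z|] //=; rewrite mulgA. Qed.

Fact mul1_1l : left_id None mul1. Proof. by []. Qed.

Fact mul1_1r : right_id None mul1. Proof. by case. Qed.

HB.instance Definition _ := isMonoid.Build (adjoin1 S) mul1A mul1_1l mul1_1r.

End Adjoin1.

Section RelativeGreen.
Variables (S : semigroupType) (T : mulgClosed S).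

Definition sub1 : {pred adjoin1 S} :=
  fun t => if t is Some x then x \in T else true.

Definition relR (u v : S) : Prop :=
  [set inc u * t | t in [set` sub1]] = [set inc v * t | t in [set` sub1]].

Definition relL (u v : S) : Prop :=
  [set t * inc u | t in [set` sub1]] = [set t * inc v | t in [set` sub1]].

Definition relH (u v : S) : Prop := relR u v /\ relL u v.

Definition Hclasses : set (set S) := range (fun u => [set v | relH u v]).

Definition outer_Hclasses : set (set S) :=
  [set H | Hclasses H /\ H `<=` ~` [set` T]].

Definition green_index (n : nat) : Prop :=
  exists2 m, (outer_Hclasses #= `I_m)%card & n = m.+1.

Definition finite_green_index : Prop := exists n, green_index n.

Fact sub1_monoid_closed : monoid_closed sub1.
Proof. by split=> // -[x|] [y|] //; apply: gpredM. Qed.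

Section Stabilizer.
Variable H : set S.

Definition in_stab : pred (adjoin1 S) := fun t =>
  (t \in sub1) && `[< [set inc h * t | h in H] = inc @` H >].

Definition stab : Type := {t | in_stab t}.

HB.instance Definition _ := SubChoice.on stab.

Fact stab_monoid_closed : monoid_closed in_stab.
Proof.
have [sub11 sub1M] := sub1_monoid_closed; split=> [|s t].
  apply/andP; split=> //; apply/asboolP.
  by apply: eq_imagel => h _; rewrite mulg1.
move=> /andP[s1 /asboolP Hs] /andP[t1 /asboolP Ht].
apply/andP; split; first exact: sub1M.
apply/asboolP; rewrite -[RHS]Ht.
transitivity ((fun x => x * t) @` [set inc h * s | h in H]).
  by rewrite image_comp; apply: eq_imagel => h _ /=; rewrite mulgA.
by rewrite Hs image_comp.
Qed.

HB.instance Definition _ :=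
  SubChoice_isSubMonoid.Build (adjoin1 S) in_stab stab stab_monoid_closed.

Definition gamma : rel stab := fun x y =>
  `[< forall h, H h -> inc h * val x = inc h * val y >].

Fact gamma_refl : reflexive gamma.
Proof. by move=> x; apply/asboolP. Qed.

Fact gamma_sym : symmetric gamma.
Proof. by move=> x y; apply/asboolP/asboolP => xy h /xy. Qed.

Fact gamma_trans : transitive gamma.
Proof.
move=> y x z /asboolP xy /asboolP yz; apply/asboolP => h Hh.
by rewrite xy // yz.
Qed.

Canonical gamma_equiv := EquivRel gamma gamma_refl gamma_sym gamma_trans.

Fact gamma_cong (x x' y y' : stab) :
  gamma x x' -> gamma y y' -> gamma (x * y) (x' * y').
Proof.
move=> /asboolP xx' /asboolP yy'; apply/asboolP => h Hh.
rewrite !gmulfM !mulgA xx' //.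
have /andP[_ /asboolP Hx'] := valP x'.
have : [set inc h * val x' | h in H] (inc h * val x') by exists h.
by rewrite Hx' => -[k Hk <-]; apply: yy'.
Qed.

End Stabilizer.

Section SchutzenbergerGroup.
Variable H : Hclasses.
Let H0 : set S := \val H.

Definition schutzenberger : Type := {eq_quot (@gamma H0)}.

HB.instance Definition _ := Choice.on schutzenberger.
HB.instance Definition _ := EqQuotient.on schutzenberger.

Definition schutz_mul : schutzenberger -> schutzenberger -> schutzenberger :=
  lift_op2 schutzenberger (@mul (stab H0)).

Fact schutz_mulE (x y : stab H0) :
  schutz_mul (\pi x) (\pi y) = \pi_schutzenberger (x * y).
Proof.
rewrite /schutz_mul; unlock; apply/eqmodP.
by apply: gamma_cong; apply/eqmodP; rewrite reprK.
Qed.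

Definition schutz_one : schutzenberger := \pi 1.

Fact schutz_mulA : associative schutz_mul.
Proof.
by elim/quotW=> x; elim/quotW=> y; elim/quotW=> z; rewrite !schutz_mulE mulgA.
Qed.

Fact schutz_mul1l : left_id schutz_one schutz_mul.
Proof. by elim/quotW=> x; rewrite schutz_mulE mul1g. Qed.

Fact schutz_mul1r : right_id schutz_one schutz_mul.
Proof. by elim/quotW=> x; rewrite schutz_mulE mulg1. Qed.

HB.instance Definition _ :=
  isMonoid.Build schutzenberger schutz_mulA schutz_mul1l schutz_mul1r.

Fact schutz_has_rinv (a : schutzenberger) : exists b, a * b = 1.
Proof.
elim/quotW: a => x.
have [u _ H0E] : Hclasses H0 by apply/set_mem/(valP H).
have Hu : H0 u by rewrite -H0E.
have /andP[x1 /asboolP Hx] := valP x.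
have [v Hv uxv] : (inc @` H0) (inc u * val x) by rewrite -Hx; exists u.
have [Ruv _] : relH u v by move: Hv; rewrite -H0E.
have [t t1 vt] : [set inc v * t | t in [set` sub1]] (inc u).
  by rewrite -Ruv; exists 1; rewrite ?mulg1 //; case: sub1_monoid_closed.
have fixH k : H0 k -> inc k * val x * t = inc k.
  move=> Hk; have [_ Luk] : relH u k by move: Hk; rewrite -H0E.
  have [s _ <-] : [set s * inc u | s in [set` sub1]] (inc k).
    by rewrite Luk; exists 1; rewrite ?mul1g //; case: sub1_monoid_closed.
  by rewrite -!mulgA (mulgA (inc u)) -uxv vt.
have Ht : in_stab H0 t.
  apply/andP; split=> //; apply/asboolP.
  transitivity ((fun y => y * t) @` (inc @` H0)); first by rewrite image_comp.
  by rewrite -[in LHS]Hx image_comp; apply: eq_imagel => k /fixH.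
exists (\pi_schutzenberger (exist _ t Ht : stab H0)); rewrite [LHS]schutz_mulE.
apply/eqmodP/asboolP => k Hk.
by rewrite gmulfM mulgA mulg1 [LHS]fixH.
Qed.

Definition schutz_inv (a : schutzenberger) : schutzenberger :=
  projT1 (cid (schutz_has_rinv a)).

HB.instance Definition _ := hasInv.Build schutzenberger schutz_inv.

Fact schutz_mulV : right_inverse 1 schutz_inv (@mul schutzenberger).
Proof. by move=> a; rewrite /schutz_inv; case: cid. Qed.

Fact schutz_Vmul : left_inverse 1 schutz_inv (@mul schutzenberger).
Proof.
move=> a; rewrite -[LHS]mulg1 -[in LHS](schutz_mulV (schutz_inv a)).
by rewrite mulgA -(mulgA _ a) schutz_mulV mulg1 schutz_mulV.
Qed.

HB.instance Definition _ :=
  Monoid_isGroup.Build schutzenberger schutz_Vmul schutz_mulV.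

End SchutzenbergerGroup.

End RelativeGreen.

(* Main.v *)
Require Import Defs.
From HB Require Import structures.
From mathcomp Require Import all_boot all_classical generic_quotient.

Set Implicit Arguments.
Unset Strict Implicit.
Unset Printing Implicit Defensive.

Local Open Scope classical_set_scope.
Local Open Scope group_scope.

(** Everything takes place in the monoid M = S^1 with its submonoid P = T^1.
    Since the adjoined identity lies in P, the complement of P in M is the
    complement of T in S, and finite Green index says that finitely many
    P-relative H-classes cover it. So S and T may be replaced by a monoid and a
    submonoid, and semigroup generation by monoid generation.

    If P is finitely generated, so is M: an element outside P is h * t with h
    one of the finitely many representatives and t in P.

    Conversely, let A be a finite generating set of M. Reading a word in A from
    the left, one can factor every product (representative) * (generator) as
    (element of P) * (representative), where 1 is the representative used for
    elements of P. Hence every w in M is t * g, where t is a product of elements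
    from a finite set Tau in P and g is 1 or a representative. When w lies in P
    but g does not, the word t is read from the right instead: t * g becomes
    k * s with s a product of elements from a second finite set Sigma in P, and
    with k a representative that stays R-related to the suffix processed so far.
    As R-related elements are both in P or both outside it, the first suffix
    product that falls into P is detected on the representative, and is there
    absorbed into Sigma; since w is in P this has to happen. So Tau and Sigma
    generate P (lemma fg_submonoid_of_monoid).

    For the Schutzenberger group of the class of h, let p = b1 ... bn in P
    stabilize the class, with the bi in a finite generating set of P. All the
    h * b1 ... bi are R-related to h, hence lie in finitely many H-classes, and
    by Green's lemma fixed multipliers move between these classes and that of h.
    Inserting them between the letters rewrites p, up to its action on the
    class, as a product of elements r_k * b * r'_k' that stabilize the class,
    exactly as in Schreier's lemma (lemma schreier). *)

(** * Finite generation of monoids *)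

Inductive submonoid_generated (M : monoidType) (B : seq M) : M -> Prop :=
| generated1 : submonoid_generated B 1
| generated_cons b x :
    b \in B -> submonoid_generated B x -> submonoid_generated B (b * x).

Definition submonoid_fg (M : monoidType) (P : {pred M}) : Prop :=
  exists B : seq M, forall x, submonoid_generated B x <-> x \in P.

Section Generated.
Variable M : monoidType.
Implicit Types (A B : seq M) (P : {pred M}).

Lemma generated_mem B b : b \in B -> submonoid_generated B b.
Proof. by move=> Bb; rewrite -[b]mulg1; apply/generated_cons/generated1. Qed.

Lemma generatedM B x y :
  submonoid_generated B x -> submonoid_generated B y ->
  submonoid_generated B (x * y).
Proof.
move=> genx geny; elim: genx => [|b z Bb _ IHz]; first by rewrite mul1g.
by rewrite -mulgA; apply: generated_cons.
Qed.

Lemma generated_sub A B x :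
  {subset A <= B} -> submonoid_generated A x -> submonoid_generated B x.
Proof.
move=> sAB; elim=> [|a y /sAB Ba _ geny]; first exact: generated1.
exact: generated_cons.
Qed.

Lemma generated_in P B x : monoid_closed P -> {subset B <= P} ->
  submonoid_generated B x -> x \in P.
Proof. by move=> [P1 PM] sBP; elim=> // b y /sBP Pb _; apply: PM. Qed.

End Generated.

(** * Green's relations relative to a submonoid *)

Section SubmonoidGreen.
Variables (M : monoidType) (P : {pred M}).
Hypothesis Pmon : monoid_closed P.

Definition subR (u v : M) : Prop :=
  (exists2 t, t \in P & v = u * t) /\ (exists2 t, t \in P & u = v * t).

Definition subL (u v : M) : Prop :=
  (exists2 t, t \in P & v = t * u) /\ (exists2 t, t \in P & u = t * v).

Definition subH (u v : M) : Prop := subR u v /\ subL u v.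

Let P1 : 1 \in P. Proof. by case: Pmon. Qed.
Let PM : mulg_closed P. Proof. by case: Pmon. Qed.

Lemma subR_refl u : subR u u.
Proof. by split; exists 1; rewrite ?mulg1. Qed.

Lemma subL_refl u : subL u u.
Proof. by split; exists 1; rewrite ?mul1g. Qed.

Lemma subH_refl u : subH u u.
Proof. by split; [apply: subR_refl | apply: subL_refl]. Qed.

Lemma subR_sym u v : subR u v -> subR v u. Proof. by case. Qed.

Lemma subL_sym u v : subL u v -> subL v u. Proof. by case. Qed.

Lemma subH_sym u v : subH u v -> subH v u.
Proof. by case=> /subR_sym ? /subL_sym. Qed.

Lemma subR_trans v u w : subR u v -> subR v w -> subR u w.
Proof.
move=> [[a Pa ->] [b Pb uE]] [[c Pc ->] [d Pd vE]]; split.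
  by exists (a * c); rewrite ?mulgA //; apply: PM.
by exists (d * b); [apply: PM | rewrite mulgA -vE].
Qed.

Lemma subL_trans v u w : subL u v -> subL v w -> subL u w.
Proof.
move=> [[a Pa ->] [b Pb uE]] [[c Pc ->] [d Pd vE]]; split.
  by exists (c * a); rewrite ?mulgA //; apply: PM.
by exists (b * d); [apply: PM | rewrite -mulgA -vE].
Qed.

Lemma subR_mull w u v : subR u v -> subR (w * u) (w * v).
Proof.
by move=> [[a Pa ->] [b Pb uE]]; split;
  [exists a | exists b]; rewrite // -mulgA // -uE.
Qed.

Lemma subL_mulr w u v : subL u v -> subL (u * w) (v * w).
Proof.
by move=> [[a Pa ->] [b Pb uE]]; split;
  [exists a | exists b]; rewrite // mulgA // -uE.
Qed.

(** The suffix t can be undone inside P, so no prefix of a word that stays in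
    the R-class leaves it. *)
Lemma subR_prefix h s t : s \in P -> t \in P ->
  subR h (h * (s * t)) -> subR h (h * s).
Proof.
move=> Ps Pt [_ [q Pq hE]]; split; first by exists s.
by exists (t * q); [apply: PM | rewrite {1}hE !mulgA].
Qed.

(** R-related elements differ by a right factor from P, and P is closed under
    products: this is what lets membership in P be read off representatives. *)
Lemma subR_in u v : subR u v -> (u \in P) = (v \in P).
Proof.
by move=> [[a Pa vE] [b Pb uE]]; apply/idP/idP => ?;
  [rewrite vE | rewrite uE]; apply: PM.
Qed.

(** Green's lemma: a right translation that stays in the R-class at one point
    does so along the whole L-class, because L-related elements are left
    multiples of one another and R is a left congruence. *)
Lemma green_translation u v t :
  subL u v -> subR u (u * t) -> subR v (v * t) /\ subL (u * t) (v * t).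
Proof.
move=> Luv Rut; split; last exact: subL_mulr.
by case: Luv => [[s Ps ->] _]; rewrite -mulgA; apply: subR_mull.
Qed.

(** By associativity a left multiple of a fixed point of t is fixed by t. *)
Lemma subL_fixed u v t : subL u v -> u * t = u -> v * t = v.
Proof. by case=> [[s _ ->] _] ut; rewrite -mulgA ut. Qed.

(** Choose t' in P with h * t * t' = h. Then t' maps the H-class of h back into
    itself and t' * t fixes that class pointwise, so t' provides the
    preimages. *)
Lemma translation_onto h k t : subH h (h * t) -> subH h k ->
  exists2 k', subH h k' & k' * t = k.
Proof.
move=> [Rht Lht] [Rhk Lhk]; have [_ [t' Pt' hE]] := Rht.
have Lhtk : subL (h * t) k := subL_trans (subL_sym Lht) Lhk.
have [] : subR k (k * t') /\ subL (h * t * t') (k * t').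
  by apply: green_translation => //; rewrite -hE; apply: subR_sym.
rewrite -hE => Rkt' Lhkt'; exists (k * t').
  by split=> //; apply: subR_trans Rkt'.
by rewrite -mulgA; apply: subL_fixed Lhtk _; rewrite mulgA -hE.
Qed.

(** * Finite generation under finite Green index *)

Section FiniteIndex.
Variable hs : seq M.
Hypothesis hsP : forall x, x \notin P -> exists2 h, h \in hs & subH x h.

(** Elements of P get the representative 1, so that a product read from a word
    is split in the same way whichever side of the boundary of P it lies on. *)
Lemma factorization : exists rep rho lam : M -> M,
  [/\ forall x, rho x \in P /\ lam x \in P,
      forall x, x = rep x * rho x /\ x = lam x * rep x,
      forall x, x \in P -> rep x = 1 &
      forall x, x \notin P -> rep x \in hs /\ subH x (rep x)].
Proof.
have: forall x, exists y : M * M * M,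
  [/\ y.1.2 \in P /\ y.2 \in P, x = y.1.1 * y.1.2 /\ x = y.2 * y.1.1,
      x \in P -> y.1.1 = 1 & x \notin P -> y.1.1 \in hs /\ subH x y.1.1].
  move=> x; have [Px | nPx] := boolP (x \in P).
    by exists (1, x, x); split; rewrite //= mul1g mulg1.
  have [h hs_h Hxh] := hsP nPx.
  have [[_ [r Pr xr]] [_ [l Pl xl]]] := Hxh.
  by exists (h, r, l).
move=> /choice[f fP].
exists (fun x => (f x).1.1), (fun x => (f x).1.2), (fun x => (f x).2).
by split=> x; case: (fP x).
Qed.

Lemma fg_monoid_of_submonoid : submonoid_fg P -> submonoid_fg (@predT M).
Proof.
have [rep [rho [lam [PP fac rep1 repP]]]] := factorization.
move=> [B genB]; exists (B ++ hs) => x; split=> // _.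
have genP y : y \in P -> submonoid_generated (B ++ hs) y.
  by move=> /genB; apply: generated_sub => z Bz; rewrite mem_cat Bz.
have [/genP // | nPx] := boolP (x \in P).
have [-> _] := fac x; apply: generatedM; last by apply: genP; case: (PP x).
by apply: generated_mem; rewrite mem_cat (repP x nPx).1 orbT.
Qed.

(** Tau collects the left cofactors that appear when representatives move to the
    right through a word in A, Sigma the right cofactors that appear when they
    move back to the left through a word in Tau. *)
Lemma fg_submonoid_of_monoid : submonoid_fg (@predT M) -> submonoid_fg P.
Proof.
have [rep [rho [lam [PP fac rep1 repP]]]] := factorization.
move=> [A genA].
pose hs1 := 1 :: hs.
have rep_hs1 x : rep x \in hs1.
  rewrite inE; have [/rep1-> | /repP[-> _]] := boolP (x \in P).
    by rewrite eqxx.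
  by rewrite orbT.
pose Tau := [seq lam (g * a) | g <- hs1, a <- A].
(* The extra 1 lets the empty word be treated as one more step. *)
pose Sigma := [seq rho (t * g) | t <- 1 :: Tau, g <- hs1].
have TauP : {subset Tau <= P}.
  by move=> _ /allpairsP[[g a] /= [_ _ ->]]; case: (PP (g * a)).
have SigmaP : {subset Sigma <= P}.
  by move=> _ /allpairsP[[t g] /= [_ _ ->]]; case: (PP (t * g)).
have push_left w g : submonoid_generated A w -> g \in hs1 ->
    exists t g', [/\ submonoid_generated Tau t, g' \in hs1 & g * w = t * g'].
  move=> genw; elim: genw g => [|a w' Aa _ IHw] g hs_g.
    by exists 1, g; rewrite mulg1 mul1g; split=> //; apply: generated1.
  have [t [g' [gent hs_g' repw']]] := IHw _ (rep_hs1 (g * a)).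
  exists (lam (g * a) * t), g'; split=> //.
    by apply: generated_cons => //; apply: allpairs_f.
  by rewrite mulgA {1}(fac (g * a)).2 -!mulgA repw'.
(* A product y not yet expressed in Tau and Sigma keeps a representative k that
   is R-related to it, so that t * y lies in P exactly when t * k does. *)
pose reduced y := submonoid_generated (Tau ++ Sigma) y \/ exists k s,
  [/\ k \in hs1, k \notin P, subR y k, submonoid_generated (Tau ++ Sigma) s &
      y = k * s].
have push_step t y k s : t \in 1 :: Tau -> k \in hs1 -> subR y k ->
    submonoid_generated (Tau ++ Sigma) s -> y = k * s -> reduced (t * y).
  move=> Tt hs_k Ryk gens yE.
  have tyE : t * y = rep (t * k) * (rho (t * k) * s).
    by rewrite yE !mulgA -(fac _).1.
  have genrho : submonoid_generated (Tau ++ Sigma) (rho (t * k) * s).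
    by apply: generated_cons => //; rewrite mem_cat allpairs_f ?orbT.
  have [Ptk | nPtk] := boolP (t * k \in P).
    by left; rewrite tyE rep1 // mul1g.
  have [hs_r [Rr _]] := repP _ nPtk.
  right; exists (rep (t * k)), (rho (t * k) * s); split=> //.
    by rewrite -(subR_in Rr).
  exact: subR_trans (subR_mull t Ryk) Rr.
have push_right t g :
    submonoid_generated Tau t -> g \in hs1 -> reduced (t * g).
  move=> gent hs_g; elim: gent => [|b t' Tb _].
    apply: (push_step _ _ g 1); rewrite ?mem_head ?mulg1 //.
      exact: subR_refl.
    exact: generated1.
  rewrite -mulgA => -[gentg | [k [s [hs_k _ Rk gens tgE]]]].
    by left; apply: generated_cons => //; rewrite mem_cat Tb.
  by apply: push_step tgE => //; rewrite inE Tb orbT.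
exists (Tau ++ Sigma) => w; split=> [|Pw].
  by apply: generated_in => // b; rewrite mem_cat => /orP[/TauP | /SigmaP].
have [t [g [gent hs_g]]] := push_left w 1 ((genA w).2 isT) (mem_head _ _).
rewrite mul1g => wE.
have [] := push_right t g gent hs_g; rewrite -wE // => -[k [s [_ nPk Rk _ _]]].
by rewrite -(subR_in Rk) Pw in nPk.
Qed.

(** The analogue of Schreier's lemma for the action of P on the R-class of h:
    the elements of C are the return words r_k * b * r'_k' of the finite graph
    whose vertices are the H-classes of that R-class, together with the r_k for
    which h * r_k is H-related to h, which end a walk. Agreement with p is only
    asked at h, which for stabilizing elements determines the whole action. *)
Lemma schreier h : h \notin P -> submonoid_fg P ->
  exists2 C : seq M, forall c, c \in C -> c \in P /\ subH h (h * c) &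
  forall p, p \in P -> subH h (h * p) ->
  exists2 z, submonoid_generated C z & h * z = h * p.
Proof.
move=> nPh [B genB].
have BP b : b \in B -> b \in P.
  by move=> Bb; apply/genB/generated_mem.
have /choice[r rP] k : exists r : M * M, subR h k ->
    [/\ r.1 \in P, r.2 \in P, h * r.1 = k & k * r.2 = h].
  have [[[a Pa kE] [b Pb hE]] | nR] := pselect (subR h k);
    last by exists (1, 1).
  by exists (a, b).
(* h itself is added as a starting point for the walk. *)
pose K := h :: hs.
pose C0 := [seq (r k).1 | k <- K] ++
  [seq x * (r k).2 | x <- [seq (r k).1 * b | k <- K, b <- B], k <- hs].
pose C := [seq c <- C0 | `[< c \in P /\ subH h (h * c) >]].
exists C => [c | p Pp Hp]; first by rewrite mem_filter => /andP[/asboolP].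
suff claim q k : submonoid_generated B q -> k \in K -> subR h k ->
    subH h (k * q) -> exists2 z, submonoid_generated C z & h * z = k * q.
  apply: (claim p h) => //; [exact/genB | exact: mem_head | exact: subR_refl].
move=> genq; elim: genq k => {p Pp Hp q}[|b q Bb genq IHq] k K_k Rhk Hkq.
  have [Pr _ hr _] := rP k Rhk.
  exists (r k).1; last by rewrite mulg1.
  apply: generated_mem; rewrite mem_filter mem_cat.
  rewrite (map_f (fun k => (r k).1)) // andbT.
  by apply/asboolP; rewrite hr; rewrite mulg1 in Hkq.
have Pb := BP _ Bb; have Pq : q \in P by apply/genB.
have Rkb : subR h (k * b).
  apply: (subR_trans Rhk); apply: (@subR_prefix k b q) => //.
  by case: Hkq => Rkq _; apply: subR_trans (subR_sym Rhk) Rkq.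
have nPkb : k * b \notin P by rewrite -(subR_in Rkb).
have [k' hs_k' [Rk' Lk']] := hsP nPkb.
have Rhk' : subR h k' := subR_trans Rkb Rk'.
have [Pr _ hr _] := rP k Rhk.
have [_ Pr' hr' k'r'] := rP k' Rhk'.
pose c := (r k).1 * b * (r k').2.
have hcE : h * c = k * b * (r k').2 by rewrite /c !mulgA hr.
have [Rc Lc] : subR (k * b) (h * c) /\ subL h (h * c).
  rewrite hcE -{1}k'r'; apply: green_translation; first exact: subL_sym.
  by rewrite k'r'; apply: subR_sym.
have Hhc : subH h (h * c) by split=> //; apply: subR_trans Rc.
have Hk'q : subH h (k' * q).
  rewrite !mulgA in Hkq; case: Hkq => Rkbq Lkbq.
  have [] := @green_translation (k * b) k' q Lk'.
    exact: subR_trans (subR_sym Rkb) Rkbq.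
  by move=> R' L'; split; [apply: subR_trans R' | apply: subL_trans L'].
have [|z genz hzE] := IHq k' _ Rhk' Hk'q.
  by rewrite inE hs_k' orbT.
exists (c * z).
  apply: generated_cons => //; rewrite mem_filter mem_cat; apply/andP; split.
    apply/asboolP; split=> //.
    by do !apply: PM => //.
  by apply/orP; right; apply: allpairs_f => //; apply: allpairs_f.
have [_ [[s _ hcs] _]] := Hhc.
(* The same left factor s relates k * b to k' and h * c to h. *)
have kbE : k * b = s * k'.
  have <- : k * b * ((r k').2 * (r k').1) = k * b.
    by apply: subL_fixed (subL_sym Lk') _; rewrite mulgA k'r' hr'.
  by rewrite mulgA -hcE hcs -mulgA hr'.
by rewrite mulgA hcs -mulgA hzE !mulgA kbE.
Qed.

End FiniteIndex.
End SubmonoidGreen.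

(** * Semigroups inside S^1 *)

Section RelativeGreenInAdjoin1.
Local Open Scope quotient_scope.
Variable S : semigroupType.

(** A nonempty product in S is a product in S^1 with at least one factor from S,
    so it does not matter whether 1 belongs to B. *)
Lemma semigroup_generatedP (B : seq (adjoin1 S)) (x : S) :
  semigroup_generated [set y | inc y \in B] x <-> submonoid_generated B (inc x).
Proof.
split=> [genx | genx A [AM sBA]].
  apply: (genx [set y | submonoid_generated B (inc y)]); split=> [y z|y] /=.
    rewrite !inE /= => geny genz.
    by rewrite (_ : inc (y * z) = inc y * inc z) //; apply: generatedM.
  exact: generated_mem.
pose inA (m : adjoin1 S) : Prop := if m is Some y then A y else True.
suff: inA (inc x) by [].
elim: genx => [//|[b|] [y|] //= Bb _ Ay].
- have := AM b y; rewrite !inE; apply=> //; exact: sBA.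
- exact: sBA.
Qed.

Lemma semigroup_fgP (A : set S) : semigroup_fg A <->
  exists B : seq (adjoin1 S), forall x, submonoid_generated B (inc x) <-> A x.
Proof.
split=> [[X /finite_seqP[s ->] <-] | [B genB]].
  exists [seq inc y | y <- s] => x.
  rewrite -semigroup_generatedP.
  suff -> : [set y | inc y \in [seq inc z | z <- s]] = [set` s] by [].
  by apply/seteqP; split=> y /=; rewrite mem_map // => ? ? [].
exists [set y | inc y \in B].
  have -> : [set y | inc y \in B] = [set` pmap id B].
    by apply/seteqP; split=> y /=; rewrite mem_pmap map_id.
  exact: finite_seq.
apply/seteqP; split=> x; first by move=> /semigroup_generatedP/genB.
by move=> /genB/semigroup_generatedP.
Qed.

Lemma submonoid_fg_adjoin1 (P : {pred adjoin1 S}) (A : set S) :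
  1 \in P -> (forall x, (inc x \in P) <-> A x) ->
  submonoid_fg P <-> semigroup_fg A.
Proof.
move=> P1 PA; rewrite semigroup_fgP; split=> -[B genB]; exists B => x.
  by rewrite genB.
case: x => [x|]; first by rewrite genB PA.
by split=> // _; apply: generated1.
Qed.

(** * The Green index and the Schutzenberger groups *)

Variable T : mulgClosed S.

Lemma relRE (u v : S) : relR T u v <-> subR (sub1 T) (inc u) (inc v).
Proof.
have [sub11 sub1M] := sub1_monoid_closed T.
split=> [uv | [[a Ta va] [b Tb ub]]].
  split.
    have [t Tt <-] : [set inc u * t | t in [set` sub1 T]] (inc v).
      by rewrite uv; exists 1; rewrite ?mulg1.
    by exists t.
  have [t Tt <-] : [set inc v * t | t in [set` sub1 T]] (inc u).
    by rewrite -uv; exists 1; rewrite ?mulg1.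
  by exists t.
apply/seteqP; split=> _ [t Tt <-].
  by exists (b * t); [apply: sub1M | rewrite mulgA -ub].
by exists (a * t); [apply: sub1M | rewrite mulgA -va].
Qed.

Lemma relLE (u v : S) : relL T u v <-> subL (sub1 T) (inc u) (inc v).
Proof.
have [sub11 sub1M] := sub1_monoid_closed T.
split=> [uv | [[a Ta va] [b Tb ub]]].
  split.
    have [t Tt <-] : [set t * inc u | t in [set` sub1 T]] (inc v).
      by rewrite uv; exists 1; rewrite ?mul1g.
    by exists t.
  have [t Tt <-] : [set t * inc v | t in [set` sub1 T]] (inc u).
    by rewrite -uv; exists 1; rewrite ?mul1g.
  by exists t.
apply/seteqP; split=> _ [t Tt <-].
  by exists (t * b); [apply: sub1M | rewrite -mulgA -ub].
by exists (t * a); [apply: sub1M | rewrite -mulgA -va].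
Qed.

Lemma relHE (u v : S) : relH T u v <-> subH (sub1 T) (inc u) (inc v).
Proof. by rewrite /relH relRE relLE. Qed.

Lemma finite_representatives : finite_green_index T ->
  exists hs : seq (adjoin1 S),
    forall x, x \notin sub1 T -> exists2 h, h \in hs & subH (sub1 T) x h.
Proof.
move=> [_ [m cardH _]].
have /finite_seqP[Hs HsE] : finite_set (outer_Hclasses T) by exists m.
have /choice[rep repP] H : exists h : adjoin1 S,
    outer_Hclasses T H -> exists2 u, h = inc u & H = [set v | relH T u v].
  have [[[u _ uH] _] | nH] := pselect (outer_Hclasses T H); last by exists 1.
  by exists (inc u) => _; exists u.
exists [seq rep H | H <- Hs] => -[x|//] nTx.
have outx : outer_Hclasses T [set v | relH T x v].
  split; first by exists x.
  move=> v /relHE[/(subR_in (sub1_monoid_closed T)) xv _] Tv.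
  by move: nTx; rewrite [_ \in _]xv => /negP; apply.
exists (rep [set v | relH T x v]).
  by apply: map_f; move: outx; rewrite HsE.
have [u -> uE] := repP _ outx.
apply/subH_sym/relHE.
have : [set v | relH T x v] x by [].
by rewrite uE.
Qed.

(** By Green's lemma a translation maps the whole class onto itself as soon as
    it keeps one of its elements in the class. *)
Lemma in_stabP (u : S) (t : adjoin1 S) :
  in_stab T [set v | relH T u v] t <->
  t \in sub1 T /\ subH (sub1 T) (inc u) (inc u * t).
Proof.
have Tmon := sub1_monoid_closed T.
split=> [/andP[Tt /asboolP tH] | [Tt Hut]].
  split=> //.
  have : [set inc h * t | h in [set v | relH T u v]] (inc u * t) by exists u.
  by rewrite tH => -[v /= /relHE ? <-].
apply/andP; split=> //; apply/asboolP/seteqP; split.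
  move=> _ [v /= /relHE[Ruv Luv] <-].
  have [Rv Lv] := green_translation Luv Hut.1.
  have : subH (sub1 T) (inc u) (inc v * t).
    split; first exact: (subR_trans Tmon Ruv Rv).
    exact: (subL_trans Tmon Hut.2 Lv).
  have : inc v * t <> None by case: (t).
  by case: (inc v * t) => [w _ Huw | //]; exists w => //; apply/relHE.
move=> _ [v /= /relHE Huv <-].
have [[k|] Hk kt] := translation_onto Tmon Hut Huv.
  by exists k => //; apply/relHE.
by case: Hk => [[[[a|] _]]].
Qed.

(** The elements of the class are left multiples of u, so the action of a
    stabilizing element is determined by its value at u. *)
Lemma gammaP (u : S) (x y : stab T [set v | relH T u v]) :
  inc u * val x = inc u * val y -> gamma x y.
Proof.
move=> uxy; apply/asboolP => v /= /relHE[_ [[s _ ->] _]].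
by rewrite -!mulgA uxy.
Qed.

(** Let the class be that of u. A product of elements of C stabilizes the class,
    and agreement with x at u makes it equal to x in the quotient; so the images
    of the elements of C generate the group, even as a monoid. *)
Lemma schutzenberger_fg (H : Hclasses T) :
  finite_green_index T -> semigroup_fg [set` T] ->
  outer_Hclasses T (\val H) -> group_fg (schutzenberger H).
Proof.
move=> finT fgT outH.
have Tmon := sub1_monoid_closed T.
have fgT1 : submonoid_fg (sub1 T) by apply/(submonoid_fg_adjoin1 _ _).2: fgT.
have [hs hsP] := finite_representatives finT.
case: H outH => H0 H0in /= outH.
have [[u _ uH] nTH] := outH; subst H0.
set H0 := [set v | relH T u v] in H0in outH nTH *.
have nTu : inc u \notin sub1 T.
  by apply/negP => Tu; apply: (nTH u) => //; apply/relHE/subH_refl.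
have [C CP genC] := schreier Tmon hsP nTu fgT1.
pose H : Hclasses T := exist _ H0 H0in.
pose pi (x : stab T H0) : schutzenberger H := \pi_(schutzenberger H) x.
exists (pi @` [set x | \val x \in C]).
  apply: finite_image.
  have -> : [set x : stab T H0 | \val x \in C] = [set` pmap insub C].
    by apply/seteqP; split=> x /=; rewrite mem_pmap_sub.
  exact: finite_seq.
apply/seteqP; split=> // a _ A [Agrp sCA].
have [A1 _] := Agrp; have AM := group_closedM Agrp.
have genA z : submonoid_generated C z -> exists2 x, \val x = z & A (pi x).
  elim=> [|c {}z Cc _ [x <- Ax]]; first by exists 1 => //; apply/set_mem: A1.
  have /in_stabP Hc := CP _ Cc.
  pose y : stab T H0 := exist _ c Hc.
  exists (y * x) => //.
  have -> : pi (y * x) = pi y * pi x by apply/esym/schutz_mulE.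
  by apply/set_mem/AM; apply/mem_set => //; apply: sCA; exists y.
elim/quotW: a => x.
have /in_stabP[Tx Hx] := valP x.
have [z /genA[y <- Ay] uy] := genC _ Tx Hx.
suff -> : \pi_(schutzenberger H) x = pi y by [].
by apply/eqmodP/gammaP.
Qed.
End RelativeGreenInAdjoin1.

Theorem theorem5p2 (S : semigroupType) (T : mulgClosed S)
  (finT : finite_green_index T) :
  (semigroup_fg [set: S] <-> semigroup_fg [set` T]) /\
  (semigroup_fg [set: S] ->
   forall H : Hclasses T, outer_Hclasses T (\val H) ->
   group_fg (schutzenberger H)).
Proof.
have Tmon := sub1_monoid_closed T.
have [hs hsP] := finite_representatives finT.
have fgS : submonoid_fg (@predT (adjoin1 S)) <-> semigroup_fg [set: S].
  exact: submonoid_fg_adjoin1.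
have fgT : submonoid_fg (sub1 T) <-> semigroup_fg [set` T].
  exact: submonoid_fg_adjoin1.
have fgST : semigroup_fg [set: S] <-> semigroup_fg [set` T].
  rewrite -fgS -fgT.
  split; first exact (fg_submonoid_of_monoid Tmon hsP).
  exact: fg_monoid_of_submonoid hsP.
by split=> // /fgST fg_T H; apply: schutzenberger_fg.
Qed.
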